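(* Let $\mathcal{E}$ be a collection of spaces and let $f:X\to Y$ and $g:Y\to Z$ be maps. Then: (1) If $f$ has a section, then $\mathcal{E}\text{-}\mathrm{secat}(gf)=\mathcal{E}\text{-}\mathrm{secat}(g)$. (2) If $g$ has a section, then $\mathcal{E}\text{-}\mathrm{secat}(gf)\le\mathcal{E}\text{-}\mathrm{secat}(f)$.
   Context: All spaces are assumed to have the homotopy type of connected CW-complexes; spaces have no base points and maps are not required to preserve base points. A collection $\mathcal{E}$ of spaces means any collection of spaces containing the one-point space $*$. A section of a map $f:X\to Y$ is a map $s:Y\to X$ with $fs\simeq\mathrm{id}_Y$ (homotopic, not necessarily equal). Given $f:X\to Y$, a subset $U\subseteq Y$ with inclusion $i:U\hookrightarrow Y$ is $\mathcal{E}$-section-categorical (with respect to $f$) if there are a space $E\in\mathcal{E}$ and maps $u:U\to E$, $v:E\to X$ with $fvu\simeq i$. The (reduced) $\mathcal{E}$-sectional category $\mathcal{E}\text{-}\mathrm{secat}(f)$ is the smallest integer $n\ge 0$ such that $Y$ has an open cover by $n+1$ subsets each of which is $\mathcal{E}$-section-categorical with respect to $f$ (and $\infty$ if no such $n$ exists). *)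

(* Defs.v *)
From HB Require Import structures.
From mathcomp Require Import all_boot all_order all_algebra.
From mathcomp Require Import all_classical all_reals all_analysis.

Set Implicit Arguments.
Unset Strict Implicit.
Unset Printing Implicit Defensive.

Import Order.TTheory GRing.Theory Num.Theory.
Import numFieldNormedType.Exports.

Local Open Scope classical_set_scope.
Local Open Scope ring_scope.

(** Free (unpointed) homotopy, with parameter in the real unit interval. *)
Definition homotopic (R : realType) (X Y : topologicalType) (f g : X -> Y) :=
  exists H : X * R -> Y,
    [/\ {within [set: X] `*` `[0, 1], continuous H},
        forall x, H (x, 0) = f x
      & forall x, H (x, 1) = g x].

Definition homotopy_equivalent (R : realType) (X Y : topologicalType) :=
  exists (f : X -> Y) (g : Y -> X),
    [/\ continuous f, continuous g,
        homotopic R (g \o f) id & homotopic R (f \o g) id].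

(** The norm on ['rV[R]_n] in the library is the sup norm, hence the explicit
    Euclidean norm; the topology is the usual one.  For [n = 0] the disk and
    its interior are a point and the sphere is empty. *)
Definition sqnorm (R : realType) (n : nat) (x : 'rV[R]_n) : R :=
  \sum_(j < n) x ord0 j ^+ 2.
Definition disk (R : realType) (n : nat) : set 'rV[R]_n :=
  [set x | sqnorm x <= 1].
Definition open_disk (R : realType) (n : nat) : set 'rV[R]_n :=
  [set x | sqnorm x < 1].
Definition sphere (R : realType) (n : nat) : set 'rV[R]_n :=
  [set x | sqnorm x = 1].
Arguments disk : clear implicits.
Arguments open_disk : clear implicits.
Arguments sphere : clear implicits.

(** CW-complexes in the sense of Whitehead.  The cells are indexed by [I];
    [phi i] is the characteristic map of the cell [i], of dimension [dim i],
    and only its values on the disk matter. *)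
Record CW_structure (R : realType) (K : topologicalType) (I : Type)
    (dim : I -> nat) (phi : forall i : I, 'rV[R]_(dim i) -> K) : Prop := {
  CW_hausdorff : hausdorff_space K;
  CW_continuous : forall i, {within disk R (dim i), continuous (phi i)};
  CW_injective : forall i, set_inj (open_disk R (dim i)) (phi i);
  CW_disjoint : trivIset [set: I] (fun i => phi i @` open_disk R (dim i));
  CW_cover : \bigcup_(i in [set: I]) (phi i @` open_disk R (dim i)) = [set: K];
  CW_closure_finite : forall i, exists F : set I,
    [/\ finite_set F, forall j, F j -> (dim j < dim i)%N
      & phi i @` sphere R (dim i) `<=`
          \bigcup_(j in F) (phi j @` open_disk R (dim j))];
  CW_weak : forall A : set K,
    (forall i, closed (A `&` (phi i @` disk R (dim i)))) -> closed A
}.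

Definition CW_complex (R : realType) (K : topologicalType) :=
  exists (I : Type) (dim : I -> nat) (phi : forall i : I, 'rV[R]_(dim i) -> K),
    CW_structure phi.

(** Connected spaces are nonempty by convention; the library's [connected]
    also holds of the empty set. *)
Definition connected_CW_type (R : realType) (X : topologicalType) :=
  exists K : topologicalType,
    [/\ CW_complex R K, [set: K] !=set0, connected [set: K]
      & homotopy_equivalent R X K].

(** The library does not put a topology on [unit], so the one-point space is
    any space with exactly one point. *)
Definition one_point (P : topologicalType) :=
  exists p : P, forall q : P, q = p.

Definition space_collection (R : realType) (E : topologicalType -> Prop) :=
  (exists P, E P /\ one_point P) /\
  (forall A, E A -> connected_CW_type R A).

Definition has_section (R : realType) (X Y : topologicalType) (f : X -> Y) :=
  exists s : Y -> X, continuous s /\ homotopic R (f \o s) id.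

(** The subset [U] carries the subspace topology and [set_val] is the
    inclusion of [U] into [Y]. *)
Definition section_categorical (R : realType) (E : topologicalType -> Prop)
    (X Y : topologicalType) (f : X -> Y) (U : set Y) :=
  exists (A : topologicalType) (u : set_type U -> A) (v : A -> X),
    [/\ E A, continuous u, continuous v
      & homotopic R (f \o v \o u) (set_val : set_type U -> Y)].

Definition secat_cover (R : realType) (E : topologicalType -> Prop)
    (X Y : topologicalType) (f : X -> Y) (n : nat) :=
  exists U : 'I_n.+1 -> set Y,
    [/\ forall i, open (U i), \bigcup_(i in [set: 'I_n.+1]) U i = [set: Y]
      & forall i, section_categorical R E f (U i)].

Definition secat (R : realType) (E : topologicalType -> Prop)
    (X Y : topologicalType) (f : X -> Y) : \bar R :=
  if pselect (exists n, `[< secat_cover R E f n >]) is left ex_n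
  then (ex_minn ex_n)%:R%:E else +oo%E.

(* Main.v *)
Require Import Defs.
From HB Require Import structures.
From mathcomp Require Import all_boot all_order all_algebra.
From mathcomp Require Import all_classical all_reals all_analysis.
From mathcomp Require Import lra.

(** Homotopies can be composed with maps on either side and concatenated.  The
    three inequalities behind the statement come from moving a categorical
    factorization [u : U -> A], [v : A -> _] of an open set [U] along the maps
    at hand:
    - if [g f v u] deforms to the inclusion of [U], then [f v] replaces [v] for
      [g], so [secat g <= secat (g f)];
    - if [s] is a section of [f] and [g v u] deforms to the inclusion, then
      [s v] replaces [v] for [g f], because [g f s v u] deforms to [g v u];
    - if [s] is a section of [g] and [f v u] deforms to the inclusion of
      [U] in [Y], then [s] followed by [u] is a map from the preimage of [U]
      under [s] to [A], and [g f v u s] deforms to [g s], hence to the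
      inclusion of that preimage in [Z].
    In the first two cases the cover is kept, in the third it is pulled back
    along [s], so the number of open sets never changes and the minima
    compare. *)

Set Implicit Arguments.
Unset Strict Implicit.
Unset Printing Implicit Defensive.

Import Order.TTheory GRing.Theory Num.Theory.
Import numFieldNormedType.Exports.

Local Open Scope classical_set_scope.
Local Open Scope ring_scope.

(** A homotopy is continuous on [X * [0, 1]] only, so changes of parameter must
    be known to land in the domain of continuity. *)
Lemma within_continuous_comp_mapsto (S T W : topologicalType) (A : set S)
    (B : set T) (h : S -> T) (k : T -> W) :
  continuous h -> (forall x, A x -> B (h x)) ->
  {within B, continuous k} -> {within A, continuous (k \o h)}.
Proof.
move=> ch hAB /subspace_continuousP ck; apply/subspace_continuousP => x Ax.
move=> V /(ck _ (hAB _ Ax)) /ch; rewrite /= /within /nbhs /=.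
by apply: filterS => y hy Ay; apply: hy; exact: hAB.
Qed.

Lemma continuous_pair (S T W : topologicalType) (h : S -> T) (k : S -> W) :
  continuous h -> continuous k -> continuous (fun x => (h x, k x)).
Proof. by move=> ch ck x; apply: cvg_pair; [exact: ch|exact: ck]. Qed.

Section Homotopy.
Variable R : realType.

Lemma homotopic_postcomp (X Y Z : topologicalType) (f f' : X -> Y)
    (g : Y -> Z) :
  continuous g -> homotopic R f f' -> homotopic R (g \o f) (g \o f').
Proof.
move=> cg [H [cH H0 H1]]; exists (g \o H); split=> [|x|x] /=.
- by move=> p; apply: (continuous_comp (cH p)); exact: cg.
- by rewrite H0.
- by rewrite H1.
Qed.

Lemma homotopic_precomp (W X Y : topologicalType) (h : W -> X)
    (f f' : X -> Y) :
  continuous h -> homotopic R f f' -> homotopic R (f \o h) (f' \o h).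
Proof.
move=> ch [H [cH H0 H1]].
exists (H \o (fun p : W * R => (h p.1, p.2))); split=> [|x|x] /=.
- apply: (within_continuous_comp_mapsto _ _ cH) => [p|p [_ p01]]; last by split.
  apply: continuous_pair => q; last exact: cvg_snd.
  by apply: continuous_comp; [exact: cvg_fst|exact: ch].
- by rewrite H0.
- by rewrite H1.
Qed.

Let continuous_affine2 (X : topologicalType) (a b : R) :
  continuous (fun p : X * R => (p.1, a * p.2 + b)).
Proof.
apply: continuous_pair => p; first exact: cvg_fst.
apply: cvgD; last exact: cvg_cst.
by apply: cvgM; [exact: cvg_cst|exact: cvg_snd].
Qed.

(** The two homotopies are run one after the other at double speed; the pieces
    live on the closed sets [X * [0, 1/2]] and [X * [1/2, 1]] and agree on
    their intersection, so they paste. *)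
Lemma homotopic_trans (X Y : topologicalType) (f2 f1 f3 : X -> Y) :
  homotopic R f1 f2 -> homotopic R f2 f3 -> homotopic R f1 f3.
Proof.
move=> [H [cH H0 H1]] [K [cK K0 K1]].
pose L (p : X * R) :=
  if p.2 <= 2^-1 then H (p.1, 2 * p.2 + 0) else K (p.1, 2 * p.2 + -1).
exists L; split=> [|x|x]; rewrite /L /=.
- have -> : [set: X] `*` `[(0 : R), 1] =
      ([set: X] `*` `[0, 2^-1]) `|` ([set: X] `*` `[2^-1, 1]).
    apply/seteqP; split=> -[x t] /=; rewrite !in_itv /=.
      move=> [_ /andP[t0 t1]]; have [t2|/ltW t2] := leP t 2^-1.
        by left; split=> //; rewrite t0.
      by right; split=> //; rewrite t2.
    case=> -[_ /andP[t0 t1]]; split=> //; apply/andP; split=> //; lra.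
  have closedXI (a b : R) : closed ([set: X] `*` `[a, b]).
    have -> : [set: X] `*` `[a, b] = snd @^-1` `[a, b].
      by apply/seteqP; split=> -[x t] //= [].
    by apply: preimage_closed => [p _|]; [exact: cvg_snd|exact: interval_closed].
  apply: withinU_continuous => //.
  + apply: (@subspace_eq_continuous _ _ _
      (H \o (fun p : X * R => (p.1, 2 * p.2 + 0)))).
      move=> [x t] /[!inE] -[_]; rewrite /from_subspace /= in_itv /=.
      by move=> /andP[_ ->].
    apply: (within_continuous_comp_mapsto (@continuous_affine2 _ _ _) _ cH).
    move=> [x t] /= [_]; rewrite !in_itv /= => /andP[t0 t1].
    by split=> //; apply/andP; split; lra.
  + apply: (@subspace_eq_continuous _ _ _
      (K \o (fun p : X * R => (p.1, 2 * p.2 + -1)))).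
      move=> [x t] /[!inE] -[_]; rewrite /from_subspace /= in_itv /=.
      move=> /andP[t0 _].
      case: ifPn => // t1.
      (* both pieces apply at time 1/2, where each of them is [f2] *)
      have -> : t = 2^-1 by apply/eqP; rewrite eq_le t0 t1.
      by rewrite addr0 mulfV ?pnatr_eq0// subrr H1 K0.
    apply: (within_continuous_comp_mapsto (@continuous_affine2 _ _ _) _ cK).
    move=> [x t] /= [_]; rewrite !in_itv /= => /andP[t0 t1].
    by split=> //; apply/andP; split; lra.
- by rewrite invr_ge0 ler0n mulr0 addr0 H0.
- by rewrite ifF ?mulr1; [rewrite (_ : 2 + -1 = 1) ?K1//; lra|apply/negbTE; lra].
Qed.

End Homotopy.

Section SectionCategorical.
Variables (R : realType) (E : topologicalType -> Prop).
Variables (X Y Z : topologicalType) (f : X -> Y) (g : Y -> Z).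

Lemma section_categorical_comp (U : set Z) : continuous f ->
  section_categorical R E (g \o f) U -> section_categorical R E g U.
Proof.
move=> cf [A [u [v [EA cu cv h]]]]; exists A, u, (f \o v); split=> //.
move=> x; exact: (continuous_comp (cv _) (cf _)).
Qed.

(** The section is inserted in the middle of [g v u]: only [f s] is deformed,
    with [g] after it and [v u] before it. *)
Lemma section_categorical_has_section (U : set Z) :
  continuous g -> has_section R f ->
  section_categorical R E g U -> section_categorical R E (g \o f) U.
Proof.
move=> cg [s [cs fs]] [A [u [v [EA cu cv h]]]].
exists A, u, (s \o v); split=> //.
  move=> x; exact: (continuous_comp (cv _) (cs _)).
apply: homotopic_trans h.
exact: (homotopic_precomp cu
  (homotopic_precomp cv (homotopic_postcomp cg fs))).
Qed.

(** The homotopy between [f v u] and the inclusion of [U] lives over [U], so it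
    has to be transported along [s] corestricted to [U]. *)
Lemma section_categorical_preimage (s : Z -> Y) (U : set Y) :
  continuous g -> continuous s -> homotopic R (g \o s) id ->
  section_categorical R E f U ->
  section_categorical R E (g \o f) (s @^-1` U).
Proof.
move=> cg cs gs [A [u [v [EA cu cv h]]]].
have val_cts (T : topologicalType) (V : set T) :
  continuous (set_val : set_type V -> T) by exact: initial_continuous.
have sU (w : set_type (s @^-1` U)) : s (set_val w) \in U.
  by have := valP w; rewrite !inE.
pose sr (w : set_type (s @^-1` U)) : set_type U := SigSub (sU w).
have csr : continuous sr.
  apply: continuous_comp_initial => w.
  exact: (continuous_comp (@val_cts _ _ w) (cs _)).
exists A, (u \o sr), v; split=> //.
  move=> w; exact: (continuous_comp (csr _) (cu _)).
apply: homotopic_trans (homotopic_precomp (val_cts _ _) gs).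
exact: (homotopic_precomp csr (homotopic_postcomp cg h)).
Qed.

End SectionCategorical.

(** Covers are compared by pulling them back along a map between the bases, so
    that one lemma serves both the case of a common base, with [s] the
    identity, and the case of a section [s]. *)
Lemma secat_cover_preimage (R : realType) (E : topologicalType -> Prop)
    (X Y X' Y' : topologicalType) (f : X -> Y) (f' : X' -> Y') (s : Y' -> Y)
    (n : nat) :
  continuous s ->
  (forall U, section_categorical R E f U ->
    section_categorical R E f' (s @^-1` U)) ->
  secat_cover R E f n -> secat_cover R E f' n.
Proof.
move=> cs sf [U [oU covU scU]]; exists (fun i => s @^-1` U i); split=> [i||i].
- by move/continuousP : cs; exact.
- by rewrite -preimage_bigcup covU preimage_setT.
- exact: sf.
Qed.

Lemma le_secat (R : realType) (E : topologicalType -> Prop)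
    (X Y X' Y' : topologicalType) (f : X -> Y) (f' : X' -> Y') :
  (forall n, secat_cover R E f n -> secat_cover R E f' n) ->
  (secat R E f' <= secat R E f)%E.
Proof.
move=> ff'; rewrite /secat.
case: (pselect (exists n, `[< secat_cover R E f n >])) => [exf|_];
  last by rewrite leey.
have exf' : exists n, `[< secat_cover R E f' n >].
  by case: exf => n /asboolP fn; exists n; apply/asboolP; exact: ff'.
case: pselect => // ex_f'.
rewrite lee_fin ler_nat.
case: (ex_minnP exf) => n /asboolP fn _.
by case: ex_minnP => m _; apply; apply/asboolP; exact: ff'.
Qed.

Theorem proposition5p2 (R : realType) (E : topologicalType -> Prop)
    (hE : space_collection R E) (X Y Z : topologicalType)
    (hX : connected_CW_type R X) (hY : connected_CW_type R Y)
    (hZ : connected_CW_type R Z)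
    (f : X -> Y) (g : Y -> Z) (hf : continuous f) (hg : continuous g) :
  (has_section R f -> secat R E (g \o f) = secat R E g) /\
  (has_section R g -> (secat R E (g \o f) <= secat R E f)%E).
Proof.
split=> [fs|[s [cs gs]]].
  have cid : continuous (@id Z) by move=> z; exact: cvg_id.
  apply/eqP; rewrite eq_le; apply/andP; split; apply: le_secat => n;
      apply: (secat_cover_preimage cid) => U.
    exact: section_categorical_has_section.
  exact: section_categorical_comp.
apply: le_secat => n; apply: (secat_cover_preimage cs) => U.
exact: section_categorical_preimage.
Qed.
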